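(* Let $G$ be a group. The group $\mathrm{Pol}_2(G)$ is isomorphic to the twisted crossed product group $(\omega(G)\otimes_{\mathbb Z}G^{ab})\rtimes_\psi G$, where $G$ acts on $\omega(G)$ by left multiplication and trivially on $G^{ab}$, and the $2$-cocycle $\psi$ is $c\otimes \mathrm{ab}$, the exterior product of the tautological $1$-cocycle $c\colon G\to\omega(G)$, $c(g)=g-1$, and the trivial $1$-cocycle $\mathrm{ab}\colon G\to G^{ab}$; that is, $\psi(g,h)=c(g)\otimes\bar h$, where $\bar h$ is the image of $h$ in $G^{ab}$.
   Context: For groups $G,H$ and $\varphi\colon G\to H$, put $(\Delta_k\varphi)(g):=\varphi(kg)\varphi(g)^{-1}$ for $k,g\in G$. A map is polynomial of degree $-1$ if it is constantly $1$, and polynomial of degree $d+1$ ($d\ge-1$) if $\Delta_k\varphi$ is polynomial of degree $d$ for all $k\in G$; quadratic means polynomial of degree $2$; unital means $\varphi(1)=1$. $\mathrm{Pol}_2(G)$ is the group with a universal unital quadratic map $\varphi\colon G\to\mathrm{Pol}_2(G)$: every unital quadratic map $\varphi'\colon G\to H$ to a group $H$ factors as $\varphi'=\theta\circ\varphi$ for a unique homomorphism $\theta\colon \mathrm{Pol}_2(G)\to H$. Concretely, $\mathrm{Pol}_2(G)$ has generators $\varphi(g)$, $g\in G$, and relations $\varphi(g_1g_2g_3)=\varphi(g_1g_2)\varphi(g_2)^{-1}\varphi(g_1)^{-1}\varphi(g_1g_3)\varphi(g_3)^{-1}\varphi(g_2g_3)$ for all $g_1,g_2,g_3\in G$. $\omega(G)$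 is the augmentation ideal of the group ring $\mathbb Z[G]$ and $G^{ab}$ is the abelianization of $G$. For a $\mathbb Z[G]$-module $M$ and a $2$-cocycle $\psi\colon G\times G\to M$, the twisted crossed product $M\rtimes_\psi G$ is the set $M\times G$ with multiplication $(\xi_1,g_1)(\xi_2,g_2)=(\xi_1+g_1\xi_2+\psi(g_1,g_2),\,g_1g_2)$. *)

(* Defs.v *)
From HB Require Import structures.
From mathcomp Require Import all_boot all_algebra.
From mathcomp Require Import finmap.
From mathcomp Require Import boolp.
From mathcomp Require Import monalg.

Set Implicit Arguments.
Unset Strict Implicit.
Unset Printing Implicit Defensive.

Import GRing.Theory.

Local Open Scope ring_scope.
Local Open Scope quotient_scope.

(* {malg int[K]} is the free abelian group on K, and malg_lift f its homomorphism
   extending f. *)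

HB.lock Definition malg_lift (K : choiceType) (V : zmodType) (f : K -> V)
  (x : {malg int[K]}) : V := \sum_(k <- msupp x) f k *~ x@_k.

Section FreeAbelian.
Variables (K : choiceType) (V : zmodType).
Implicit Types (f : K -> V) (x y : {malg int[K]}).

Lemma malg_liftEw f x (d : {fset K}) :
  (msupp x `<=` d)%fset -> malg_lift f x = \sum_(k <- d) f k *~ x@_k.
Proof.
move=> le; rewrite malg_lift.unlock; apply/big_fset_incl => // k _ /mcoeff_outdom ->.
by rewrite mulr0z.
Qed.

Lemma malg_lift_is_zmod_morphism f : zmod_morphism (malg_lift f).
Proof.
move=> x y; pose d := (msupp x `|` msupp y)%fset.
rewrite (malg_liftEw f (msuppB_le x y)).
rewrite (malg_liftEw f (fsubsetUl (msupp x) (msupp y))).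
rewrite (malg_liftEw f (fsubsetUr (msupp x) (msupp y))).
by rewrite -sumrB; apply/eq_bigr => k _; rewrite mcoeffB mulrzBr.
Qed.

HB.instance Definition _ f :=
  GRing.isZmodMorphism.Build {malg int[K]} V (malg_lift f)
    (malg_lift_is_zmod_morphism f).

Lemma malg_liftU f n k : malg_lift f << n *g k >> = f k *~ n.
Proof. by rewrite (malg_liftEw f msuppU_le) big_seq_fset1 mcoeffUU. Qed.

Lemma malg_ind (P : {malg int[K]} -> Prop) :
  P 0 -> (forall x y, P x -> P y -> P (x - y)) -> (forall k, P << k >>) ->
  forall x, P x.
Proof.
move=> P0 PB PU x.
have PN y : P y -> P (- y) by move=> Py; rewrite -sub0r; apply: PB.
have PD y z : P y -> P z -> P (y + z).
  by move=> Py Pz; rewrite -(opprK z); apply/PB/PN.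
rewrite [x]monalgE; elim/big_ind: _ => // k _.
have Pn (n : nat) : P << n%:Z *g k >>.
  elim: n => [|n IHn]; first by rewrite monalgU0.
  by rewrite intS monalgUD; apply: PD.
case: (x@_k) => n; first exact: Pn.
by rewrite NegzE monalgUN; apply/PN/Pn.
Qed.

Lemma malg_liftB f f' x :
  malg_lift (fun k => f k - f' k) x = malg_lift f x - malg_lift f' x.
Proof. by rewrite malg_lift.unlock -sumrB; apply/eq_bigr => k _; rewrite mulrzBl. Qed.

End FreeAbelian.

(* Z[G], on the free abelian group on G. The product that monalg puts on
   {malg int[K]} is unavailable here: a monomType has no nontrivial units. *)
Definition group_ring (G : groupType) : Type := {malg int[G]}.

HB.instance Definition _ (G : groupType) := GRing.Zmodule.on (group_ring G).

Definition gr (G : groupType) (g : G) : group_ring G := << g >>.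

HB.lock Definition gr_mul (G : groupType) (x y : group_ring G) : group_ring G :=
  malg_lift (fun g => malg_lift (fun h => gr (g * h)%g) y) x.

HB.lock Definition augmentation (G : groupType) (x : group_ring G) : int :=
  malg_lift (fun=> 1) x.

Section GroupRing.
Variable G : groupType.
Local Notation ZG := (group_ring G).
Implicit Types (g h k : G) (x y z : ZG).

Lemma gr_ind (P : ZG -> Prop) :
  P 0 -> (forall x y, P x -> P y -> P (x - y)) -> (forall g, P (gr g)) ->
  forall x, P x.
Proof. exact: malg_ind. Qed.

Fact gr_mulBl x y z : gr_mul (x - y) z = gr_mul x z - gr_mul y z.
Proof. rewrite gr_mul.unlock; exact: malg_lift_is_zmod_morphism. Qed.

Fact gr_mulBr x y z : gr_mul x (y - z) = gr_mul x y - gr_mul x z.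
Proof.
rewrite gr_mul.unlock -malg_liftB; congr malg_lift.
by apply/funext => g; apply: malg_lift_is_zmod_morphism.
Qed.

Fact gr_mulgg g h : gr_mul (gr g) (gr h) = gr (g * h)%g.
Proof. by rewrite gr_mul.unlock !malg_liftU. Qed.

Fact gr_mul0l x : gr_mul 0 x = 0.
Proof. by rewrite -[X in gr_mul X _](subrr 0) gr_mulBl subrr. Qed.

Fact gr_mul0r x : gr_mul x 0 = 0.
Proof. by rewrite -[X in gr_mul _ X](subrr 0) gr_mulBr subrr. Qed.

Fact gr_mulDl : left_distributive (@gr_mul G) +%R.
Proof.
move=> x y z; rewrite -{1}[y]opprK gr_mulBl -(sub0r y) gr_mulBl.
by rewrite gr_mul0l sub0r opprK.
Qed.

Fact gr_mulDr : right_distributive (@gr_mul G) +%R.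
Proof.
move=> x y z; rewrite -{1}[z]opprK gr_mulBr -(sub0r z) gr_mulBr.
by rewrite gr_mul0r sub0r opprK.
Qed.

Fact gr_mulA : associative (@gr_mul G).
Proof.
move=> x y z; elim/gr_ind: x => [|x x' IHx IHx'|g].
- by rewrite !gr_mul0l.
- by rewrite !gr_mulBl IHx IHx'.
elim/gr_ind: y => [|y y' IHy IHy'|h].
- by rewrite !(gr_mul0l, gr_mul0r).
- by rewrite !(gr_mulBl, gr_mulBr) IHy IHy'.
elim/gr_ind: z => [|z z' IHz IHz'|k].
- by rewrite !gr_mul0r.
- by rewrite !gr_mulBr IHz IHz'.
by rewrite !gr_mulgg mulgA.
Qed.

Fact gr_mul1l : left_id (gr 1%g) (@gr_mul G).
Proof.
move=> x; elim/gr_ind: x => [|x y IHx IHy|g].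
- exact: gr_mul0r.
- by rewrite gr_mulBr IHx IHy.
- by rewrite gr_mulgg mul1g.
Qed.

Fact gr_mul1r : right_id (gr 1%g) (@gr_mul G).
Proof.
move=> x; elim/gr_ind: x => [|x y IHx IHy|g].
- exact: gr_mul0l.
- by rewrite gr_mulBl IHx IHy.
- by rewrite gr_mulgg mulg1.
Qed.

Fact gr1_neq0 : gr (1%g : G) != 0.
Proof. by rewrite monalgU_eq0. Qed.

HB.instance Definition _ := GRing.Zmodule_isNzRing.Build ZG
  gr_mulA gr_mul1l gr_mul1r gr_mulDl gr_mulDr gr1_neq0.

Lemma gr1 : gr (1%g : G) = 1.
Proof. by []. Qed.

Lemma grM g h : gr (g * h)%g = gr g * gr h.
Proof. by rewrite [RHS]gr_mulgg. Qed.

Fact augmentation_is_zmod_morphism : zmod_morphism (@augmentation G).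
Proof. rewrite augmentation.unlock; exact: malg_lift_is_zmod_morphism. Qed.

HB.instance Definition _ :=
  GRing.isZmodMorphism.Build ZG int (@augmentation G) augmentation_is_zmod_morphism.

Lemma augmentation_gr g : augmentation (gr g) = 1.
Proof. by rewrite augmentation.unlock malg_liftU. Qed.

Fact augmentation_is_monoid_morphism : monoid_morphism (@augmentation G).
Proof.
split=> [|x y]; first by rewrite -gr1 augmentation_gr.
elim/gr_ind: x => [|x x' IHx IHx'|g].
- by rewrite mul0r raddf0 mul0r.
- by rewrite mulrBl !raddfB /= IHx IHx' mulrBl.
elim/gr_ind: y => [|y y' IHy IHy'|h].
- by rewrite mulr0 raddf0 mulr0.
- by rewrite mulrBr !raddfB /= IHy IHy' mulrBr.
by rewrite -grM !augmentation_gr mulr1.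
Qed.

HB.instance Definition _ :=
  GRing.isMonoidMorphism.Build ZG int (@augmentation G)
    augmentation_is_monoid_morphism.

Definition augmentation_ideal : {pred ZG^o} := [pred x | augmentation x == 0].

Fact augmentation_ideal_submod_closed : submod_closed augmentation_ideal.
Proof.
split=> [|r x y]; rewrite !inE ?raddf0 // => /eqP x0 /eqP y0.
by rewrite raddfD /= rmorphM /= x0 y0 mulr0.
Qed.

HB.instance Definition _ :=
  GRing.isSubmodClosed.Build ZG ZG^o augmentation_ideal
    augmentation_ideal_submod_closed.

(* omega(G), with Z[G] (hence G, through gr) acting by left multiplication. *)
Record omega := Omega {
  omega_val :> ZG^o;
  omega_valP : omega_val \in augmentation_ideal
}.

HB.instance Definition _ := [isSub for omega_val].
HB.instance Definition _ := [Choice of omega by <:].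
HB.instance Definition _ := [SubChoice_isSubZmodule of omega by <:].
HB.instance Definition _ := [SubZmodule_isSubLmodule of omega by <:].

Fact gr_sub1_proof g : (gr g - 1 : ZG^o) \in augmentation_ideal.
Proof. by rewrite inE raddfB /= augmentation_gr rmorph1 subrr. Qed.

Definition taut_cocycle (g : G) : omega := Omega (gr_sub1_proof g).

Lemma taut_cocycleM g h :
  taut_cocycle (g * h)%g = taut_cocycle g + gr g *: taut_cocycle h.
Proof.
apply: val_inj => /=; rewrite [RHS]addrC grM.
by rewrite [gr g *: _]mulrBr mulr1 addrA subrK.
Qed.

End GroupRing.

(* Z[G]-module structure on an abelian group with an additive action of G. *)
Section LinearizedAction.
Variables (G : groupType) (V : zmodType) (rho : G -> V -> V).

Definition act_scale (r : group_ring G) (v : V) : V :=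
  malg_lift (fun g => rho g v) r.

Hypothesis rhoB : forall g, zmod_morphism (rho g).
Hypothesis rho1 : forall v, rho 1%g v = v.
Hypothesis rhoM : forall g h v, rho (g * h)%g v = rho g (rho h v).

Fact act_scaleBl v r s : act_scale (r - s) v = act_scale r v - act_scale s v.
Proof. exact: malg_lift_is_zmod_morphism. Qed.

Fact act_scaleBr r v w : act_scale r (v - w) = act_scale r v - act_scale r w.
Proof.
rewrite /act_scale -malg_liftB; congr malg_lift.
by apply/funext => g; apply: rhoB.
Qed.

Fact act_scale_gr g v : act_scale (gr g) v = rho g v.
Proof. by rewrite /act_scale malg_liftU. Qed.

Fact act_scale0l v : act_scale 0 v = 0.
Proof. by rewrite -[X in act_scale X _](subrr 0) act_scaleBl subrr. Qed.

Fact act_scale0r r : act_scale r 0 = 0.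
Proof. by rewrite -[X in act_scale _ X](subrr 0) act_scaleBr subrr. Qed.

Fact act_scaleA r s v : act_scale r (act_scale s v) = act_scale (r * s) v.
Proof.
elim/gr_ind: r => [|r r' IHr IHr'|g].
- by rewrite mul0r !act_scale0l.
- by rewrite mulrBl !act_scaleBl IHr IHr'.
elim/gr_ind: s => [|s s' IHs IHs'|h].
- by rewrite mulr0 !act_scale0l act_scale0r.
- by rewrite mulrBr !act_scaleBl act_scaleBr IHs IHs'.
by rewrite -grM !act_scale_gr rhoM.
Qed.

Fact act_scale1 : left_id 1 act_scale.
Proof. by move=> v; rewrite -gr1 act_scale_gr. Qed.

Fact act_scaleDr : right_distributive act_scale +%R.
Proof.
move=> r v w; rewrite -{1}[w]opprK act_scaleBr -(sub0r w) act_scaleBr.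
by rewrite act_scale0r sub0r opprK.
Qed.

Fact act_scaleDl v : {morph act_scale^~ v : r s / r + s}.
Proof.
move=> r s; rewrite -{1}[s]opprK act_scaleBl -(sub0r s) act_scaleBl.
by rewrite act_scale0l sub0r opprK.
Qed.

End LinearizedAction.

Section Abelianization.
Variable G : groupType.
Implicit Types x y z : G.

(* The commutator subgroup [G, G]. *)
Inductive derived : G -> Prop :=
| derived_comm x y : derived [~ x, y]%g
| derived1 : derived 1%g
| derivedM x y : derived x -> derived y -> derived (x * y)%g
| derivedV x : derived x -> derived x^-1%g.

Lemma derivedJ x y : derived x -> derived (x ^ y)%g.
Proof.
move=> dx; have -> : (x ^ y = x * [~ x, y])%g by rewrite /commg mulVKg.
by apply: derivedM => //; apply: derived_comm.
Qed.

Definition ab_equiv x y := `[< derived (x * y^-1)%g >].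

Fact ab_equiv_is_equiv : equiv_class_of ab_equiv.
Proof.
split=> [x|x y|y x z]; rewrite /ab_equiv.
- by apply/asboolP; rewrite mulgV; apply: derived1.
- apply/idP/idP => /asboolP d; apply/asboolP;
  by rewrite -[X in derived X]invgK invgM invgK; apply: derivedV.
- move=> /asboolP d1 /asboolP d2; apply/asboolP.
  by rewrite -[x](mulgVK y) -mulgA; apply: derivedM.
Qed.

Canonical ab_equiv_equiv := EquivRelPack ab_equiv_is_equiv.
Canonical ab_equiv_encModRel := defaultEncModRel ab_equiv.

Definition abelianization := {eq_quot ab_equiv}.
HB.instance Definition _ : EqQuotient G ab_equiv abelianization :=
  EqQuotient.on abelianization.
HB.instance Definition _ := Choice.on abelianization.

Definition ab (x : G) : abelianization := \pi_abelianization x.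

Lemma ab_eqP x y : ab x = ab y <-> derived (x * y^-1)%g.
Proof.
by split=> [/eqquotP/asboolP|d] //; apply/eqquotP/asboolP.
Qed.

Definition ab_zero : abelianization := ab 1%g.
Definition ab_add (a b : abelianization) : abelianization :=
  ab (repr a * repr b)%g.
Definition ab_opp (a : abelianization) : abelianization := ab (repr a)^-1%g.

Fact ab_surj (a : abelianization) : exists x, a = ab x.
Proof. by exists (repr a); rewrite /ab reprK. Qed.

Fact ab_repr x : derived (repr (ab x) * x^-1)%g.
Proof. by apply/ab_eqP; rewrite /ab reprK. Qed.

Fact ab_addE x y : ab_add (ab x) (ab y) = ab (x * y)%g.
Proof.
apply/ab_eqP; move: (ab_repr x) (ab_repr y).
move: (repr (ab x)) (repr (ab y)) => x' y' dx dy.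
have -> : (x' * y' * (x * y)^-1 = (x' * x^-1) * (y' * y^-1) ^ x^-1)%g.
  by rewrite conjgE invgK invgM -!mulgA mulKg.
by apply: derivedM => //; apply: derivedJ.
Qed.

Fact ab_oppE x : ab_opp (ab x) = ab x^-1%g.
Proof.
apply/ab_eqP; move: (ab_repr x); move: (repr _) => x' dx.
have -> : (x'^-1 * x^-1^-1 = (x' * x^-1)^-1 ^ x')%g.
  by rewrite conjgE invgM !invgK -!mulgA mulVg mulg1.
by apply/derivedJ/derivedV.
Qed.

Fact ab_addA : associative ab_add.
Proof.
move=> a b c; have [x ->] := ab_surj a; have [y ->] := ab_surj b.
by have [z ->] := ab_surj c; rewrite !ab_addE mulgA.
Qed.

Fact ab_addC : commutative ab_add.
Proof.
move=> a b; have [x ->] := ab_surj a; have [y ->] := ab_surj b.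
rewrite !ab_addE; apply/ab_eqP.
have -> : (x * y * (y * x)^-1 = [~ x^-1, y^-1])%g.
  by rewrite commgEl conjgE !invgK invgM -!mulgA.
exact: derived_comm.
Qed.

Fact ab_add0 : left_id ab_zero ab_add.
Proof. by move=> a; have [x ->] := ab_surj a; rewrite ab_addE mul1g. Qed.

Fact ab_addN : left_inverse ab_zero ab_opp ab_add.
Proof. by move=> a; have [x ->] := ab_surj a; rewrite ab_oppE ab_addE mulVg. Qed.

HB.instance Definition _ :=
  GRing.isZmodule.Build abelianization ab_addA ab_addC ab_add0 ab_addN.

Lemma abM x y : ab (x * y)%g = ab x + ab y.
Proof. by rewrite [RHS]ab_addE. Qed.

Fact trivial_actB (g : G) : zmod_morphism (id : abelianization -> abelianization).
Proof. by []. Qed.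

(* G acts trivially on its abelianization. *)
HB.instance Definition _ :=
  GRing.Zmodule_isLmodule.Build (group_ring G) abelianization
    (act_scaleA (rho := fun=> id) trivial_actB (fun _ _ _ => erefl))
    (act_scale1 (rho := fun=> id) (fun=> erefl))
    (act_scaleDr (rho := fun=> id) trivial_actB)
    (act_scaleDl (fun=> id)).

Lemma gr_scale_ab (g : G) (a : abelianization) : gr g *: a = a.
Proof. exact: act_scale_gr. Qed.

End Abelianization.

(* The tensor product over Z: the free abelian group on A * B modulo the
   subgroup generated by the bilinearity relations. *)
Section Tensor.
Variables A B : zmodType.
Implicit Types (a : A) (b : B).

Inductive bilin_rel : {malg int[(A * B)%type]} -> Prop :=
| bilin_rel0 : bilin_rel 0
| bilin_relB x y : bilin_rel x -> bilin_rel y -> bilin_rel (x - y)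
| bilin_rell a a' b :
    bilin_rel (<< (a + a', b) >> - << (a, b) >> - << (a', b) >>)
| bilin_relr a b b' :
    bilin_rel (<< (a, b + b') >> - << (a, b) >> - << (a, b') >>).

Definition bilin_ideal : {pred {malg int[(A * B)%type]}} := [pred x | `[< bilin_rel x >]].

Fact bilin_ideal_zmod_closed : zmod_closed bilin_ideal.
Proof.
split=> [|x y]; rewrite !inE; first by apply/asboolP; apply: bilin_rel0.
by move=> /asboolP xS /asboolP yS; apply/asboolP; apply: bilin_relB.
Qed.

HB.instance Definition _ := GRing.isZmodClosed.Build {malg int[(A * B)%type]}
  bilin_ideal bilin_ideal_zmod_closed.

Definition tensor := Quotient.quot bilin_ideal.
HB.instance Definition _ := GRing.Zmodule.on tensor.

Definition tens (a : A) (b : B) : tensor := \pi_(Quotient.quot bilin_ideal) << (a, b) >>.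

Fact tensor_pi_eq (x y : {malg int[(A * B)%type]}) :
  bilin_rel (x - y) -> \pi_(Quotient.quot bilin_ideal) x = \pi_(Quotient.quot bilin_ideal) y.
Proof. by move=> xy; apply/eqP; rewrite -Quotient.idealrBE inE; apply/asboolP. Qed.

Lemma tensDl a a' b : tens (a + a') b = tens a b + tens a' b.
Proof.
rewrite /tens -raddfD; apply: tensor_pi_eq.
by rewrite opprD addrA; apply: bilin_rell.
Qed.

Lemma tensDr a b b' : tens a (b + b') = tens a b + tens a b'.
Proof.
rewrite /tens -raddfD; apply: tensor_pi_eq.
by rewrite opprD addrA; apply: bilin_relr.
Qed.

Lemma tensor_ind (P : tensor -> Prop) :
  P 0 -> (forall t u, P t -> P u -> P (t - u)) -> (forall a b, P (tens a b)) ->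
  forall t, P t.
Proof.
move=> P0 PB PU t; rewrite -[t]reprK.
elim/malg_ind: (repr t) => [|x y Px Py|[a b]]; first by rewrite raddf0.
  by rewrite raddfB; apply: PB.
exact: PU.
Qed.

Section Lift.
Variables (V : zmodType) (f : A -> B -> V).

Definition tensor_lift (t : tensor) : V :=
  malg_lift (fun ab => f ab.1 ab.2) (repr t).

Hypothesis fDl : forall a a' b, f (a + a') b = f a b + f a' b.
Hypothesis fDr : forall a b b', f a (b + b') = f a b + f a b'.

Fact tensor_lift_pi (x : {malg int[(A * B)%type]}) :
  tensor_lift (\pi_(Quotient.quot bilin_ideal) x) = malg_lift (fun ab => f ab.1 ab.2) x.
Proof.
apply/eqP; rewrite -subr_eq0 /tensor_lift -raddfB.
have /asboolP : repr (\pi_(Quotient.quot bilin_ideal) x) - x \in bilin_ideal.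
  by rewrite Quotient.idealrBE reprK.
elim=> [|y z _ /eqP y0 _ /eqP z0|a a' b|a b b'].
- by rewrite raddf0.
- by rewrite raddfB /= y0 z0 subrr.
- by rewrite !raddfB /= !malg_liftU /= !mulr1z fDl addrAC addrK subrr.
- by rewrite !raddfB /= !malg_liftU /= !mulr1z fDr addrAC addrK subrr.
Qed.

Lemma tensor_lift_tens a b : tensor_lift (tens a b) = f a b.
Proof. by rewrite tensor_lift_pi malg_liftU. Qed.

Lemma tensor_lift_is_zmod_morphism : zmod_morphism tensor_lift.
Proof.
move=> t u; rewrite -[t]reprK -[u]reprK -raddfB !tensor_lift_pi.
exact: raddfB.
Qed.

End Lift.
End Tensor.

Section DiagonalAction.
Variables (G : groupType) (A B : lmodType (group_ring G)).

Definition diag_act (g : G) : tensor A B -> tensor A B :=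
  tensor_lift (fun a b => tens (gr g *: a) (gr g *: b)).

Fact diag_act_tens g a b : diag_act g (tens a b) = tens (gr g *: a) (gr g *: b).
Proof.
by rewrite /diag_act tensor_lift_tens // => *;
  rewrite scalerDr ?tensDl ?tensDr.
Qed.

Fact diag_actB g : zmod_morphism (diag_act g).
Proof.
by apply: tensor_lift_is_zmod_morphism => *; rewrite scalerDr ?tensDl ?tensDr.
Qed.

Fact diag_act0 g : diag_act g 0 = 0.
Proof. by rewrite -[X in diag_act g X](subrr 0) diag_actB subrr. Qed.

Fact diag_act1 t : diag_act 1%g t = t.
Proof.
elim/tensor_ind: t => [|t u IHt IHu|a b]; first exact: diag_act0.
  by rewrite diag_actB IHt IHu.
by rewrite diag_act_tens gr1 !scale1r.
Qed.

Fact diag_actM g h t : diag_act (g * h)%g t = diag_act g (diag_act h t).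
Proof.
elim/tensor_ind: t => [|t u IHt IHu|a b]; first by rewrite !diag_act0.
  by rewrite !diag_actB IHt IHu.
by rewrite !diag_act_tens !grM !scalerA.
Qed.

(* G acts diagonally on a tensor product of G-modules. *)
HB.instance Definition _ :=
  GRing.Zmodule_isLmodule.Build (group_ring G) (tensor A B)
    (act_scaleA diag_actB diag_actM) (act_scale1 diag_act1)
    (act_scaleDr diag_actB) (act_scaleDl diag_act).

Lemma gr_scale_tens g (a : A) (b : B) :
  gr g *: tens a b = tens (gr g *: a) (gr g *: b).
Proof. by rewrite -diag_act_tens; apply: act_scale_gr. Qed.

End DiagonalAction.

Record cocycle2 (G : groupType) (M : lmodType (group_ring G)) := Cocycle2 {
  cocycle2_fun :> G -> G -> M;
  cocycle2P : forall g h k,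
    gr g *: cocycle2_fun h k - cocycle2_fun (g * h)%g k
      + cocycle2_fun g (h * k)%g - cocycle2_fun g h = 0
}.

(* psi only selects the group structure below. *)
Definition crossed_product (G : groupType) (M : lmodType (group_ring G))
  (psi : cocycle2 M) : Type := (M * G)%type.

Section CrossedProduct.
Variables (G : groupType) (M : lmodType (group_ring G)) (psi : cocycle2 M).

HB.instance Definition _ := Choice.on (crossed_product psi).

Implicit Types u v : crossed_product psi.

Definition crossed_mul u v : crossed_product psi :=
  (u.1 + gr u.2 *: v.1 + psi u.2 v.2, (u.2 * v.2)%g).

Definition crossed_one : crossed_product psi := (- psi 1%g 1%g, 1%g).

Definition crossed_inv u : crossed_product psi :=
  (- psi 1%g 1%g - gr u.2^-1%g *: u.1 - psi u.2^-1%g u.2, u.2^-1%g).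

Fact cocycle2E g h k :
  gr g *: psi h k + psi g (h * k)%g = psi (g * h)%g k + psi g h.
Proof.
apply/eqP; rewrite -subr_eq0 -[X in _ == X](cocycle2P psi g h k) opprD addrA.
by rewrite (addrAC (gr g *: _)).
Qed.

Fact cocycle2_1l h : psi 1%g h = psi 1%g 1%g.
Proof.
have := cocycle2E 1%g 1%g h; rewrite gr1 scale1r !mul1g.
by move/addrI.
Qed.

Fact cocycle2_1r g : psi g 1%g = gr g *: psi 1%g 1%g.
Proof.
have := cocycle2E g 1%g 1%g; rewrite !mulg1.
by move/addIr.
Qed.

Fact crossed_mulA : associative crossed_mul.
Proof.
move=> [x g] [y h] [z k]; rewrite /crossed_mul /= mulgA; congr (_, _).
rewrite !scalerDr scalerA -grM -!addrA; congr (_ + (_ + _)).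
by rewrite [RHS]addrCA; congr (_ + _); rewrite cocycle2E addrC.
Qed.

Fact crossed_mul1l : left_id crossed_one crossed_mul.
Proof.
move=> [x g]; rewrite /crossed_mul /= mul1g gr1 scale1r cocycle2_1l.
by rewrite addrAC addNr add0r.
Qed.

Fact crossed_mul1r : right_id crossed_one crossed_mul.
Proof.
move=> [x g]; rewrite /crossed_mul /= mulg1 scalerN (cocycle2_1r g).
by rewrite subrK.
Qed.

Fact crossed_mulVl : left_inverse crossed_one crossed_inv crossed_mul.
Proof.
move=> [x g]; rewrite /crossed_mul /crossed_inv /crossed_one /= mulVg.
by congr (_, _); rewrite addrAC subrK subrK.
Qed.

Fact crossed_mulVr : right_inverse crossed_one crossed_inv crossed_mul.
Proof.
move=> [x g]; rewrite /crossed_mul /crossed_inv /crossed_one /= mulgV.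
congr (_, _).
have := cocycle2E g g^-1%g g; rewrite mulVg mulgV (cocycle2_1r g) (cocycle2_1l g) => E.
rewrite !scalerBr scalerA -grM mulgV gr1 scale1r scalerN.
have -> : gr g *: psi g^-1%g g = psi 1%g 1%g + psi g g^-1%g - gr g *: psi 1%g 1%g.
  by rewrite -E addrK.
rewrite !opprD opprK !addrA [x - _]addrC addrK [LHS]addrAC subrK addrAC.
by rewrite addNr add0r.
Qed.


HB.instance Definition _ := isGroup.Build (crossed_product psi)
  crossed_mulA crossed_mul1l crossed_mul1r crossed_mulVl crossed_mulVr.

End CrossedProduct.

Section Psi.
Variable G : groupType.

(* The product of the 1-cocycles taut_cocycle and ab. *)
Definition psi_fun (g h : G) : tensor (omega G) (abelianization G) :=
  tens (taut_cocycle g) (ab h).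

Fact psi_cocycle (g h k : G) :
  gr g *: psi_fun h k - psi_fun (g * h)%g k
    + psi_fun g (h * k)%g - psi_fun g h = 0.
Proof.
have cancel (V : zmodType) (a b d : V) : a - (b + a) + (d + b) - d = 0.
  by rewrite (addrC b a) opprD [a + _]addrA subrr sub0r (addrC d b) addKr subrr.
rewrite /psi_fun gr_scale_tens gr_scale_ab taut_cocycleM abM tensDl tensDr.
exact: cancel.
Qed.

Definition psi : cocycle2 (tensor (omega G) (abelianization G)) :=
  Cocycle2 psi_cocycle.

End Psi.

(* is_poly n phi: phi is polynomial of degree n - 1. *)
Section Polynomial.
Variables G H : groupType.

Definition Delta (k : G) (phi : G -> H) (g : G) : H :=
  (phi (k * g) * (phi g)^-1)%g.

Fixpoint is_poly (n : nat) (phi : G -> H) : Prop :=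
  if n is m.+1 then forall k, is_poly m (Delta k phi)
  else forall g, phi g = 1%g.

Definition quadratic (phi : G -> H) := is_poly 3 phi.

Definition unital (phi : G -> H) := phi 1%g = 1%g.

End Polynomial.

(* Pol_2(G) by generators and relations: the quotient of the words by the least
   congruence containing the relations. pol2_universal below is its universal
   property.
   Words in the letters (g, false), standing for phi(g), and (g, true),
   standing for phi(g)^-1. *)
Section Pol2.
Variable G : groupType.
Local Notation word := (seq (G * bool)).
Implicit Types u v w : word.

Definition word_inv w : word := rev [seq (x.1, ~~ x.2) | x <- w].

Inductive pol2_equiv : word -> word -> Prop :=
| pol2_refl u : pol2_equiv u u
| pol2_sym u v : pol2_equiv u v -> pol2_equiv v u
| pol2_trans u v w : pol2_equiv u v -> pol2_equiv v w -> pol2_equiv u w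
| pol2_cat u u' v v' :
    pol2_equiv u u' -> pol2_equiv v v' -> pol2_equiv (u ++ v) (u' ++ v')
| pol2_cancel g b : pol2_equiv [:: (g, b); (g, ~~ b)] [::]
| pol2_rel (g1 g2 g3 : G) :
    pol2_equiv [:: ((g1 * g2 * g3)%g, false)]
      [:: ((g1 * g2)%g, false); (g2, true); (g1, true); ((g1 * g3)%g, false);
          (g3, true); ((g2 * g3)%g, false)].

Definition pol2_equivb u v := `[< pol2_equiv u v >].

Fact pol2_equiv_is_equiv : equiv_class_of pol2_equivb.
Proof.
split=> [u|u v|v u w]; rewrite /pol2_equivb.
- exact/asboolP/pol2_refl.
- by apply/idP/idP => /asboolP e; apply/asboolP/pol2_sym.
- by move=> /asboolP e1 /asboolP e2; apply/asboolP/(pol2_trans e1 e2).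
Qed.

Canonical pol2_equivb_equiv := EquivRelPack pol2_equiv_is_equiv.
Canonical pol2_equivb_encModRel := defaultEncModRel pol2_equivb.

Definition Pol2 := {eq_quot pol2_equivb}.
HB.instance Definition _ : EqQuotient word pol2_equivb Pol2 :=
  EqQuotient.on Pol2.
HB.instance Definition _ := Choice.on Pol2.

Definition pol2_class w : Pol2 := \pi_Pol2 w.

Lemma pol2_classP u v : pol2_class u = pol2_class v <-> pol2_equiv u v.
Proof. by split=> [/eqquotP/asboolP|e] //; apply/eqquotP/asboolP. Qed.

Lemma pol2_repr w : pol2_equiv (repr (pol2_class w)) w.
Proof. by apply/pol2_classP; rewrite /pol2_class reprK. Qed.

Lemma pol2_classK (a : Pol2) : pol2_class (repr a) = a.
Proof. exact: reprK. Qed.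

Definition pol2_one : Pol2 := pol2_class [::].
Definition pol2_mul (a b : Pol2) : Pol2 := pol2_class (repr a ++ repr b).
Definition pol2_inv (a : Pol2) : Pol2 := pol2_class (word_inv (repr a)).

Fact word_inv_cat u v : word_inv (u ++ v) = word_inv v ++ word_inv u.
Proof. by rewrite /word_inv map_cat rev_cat. Qed.

Fact word_invK : involutive word_inv.
Proof.
move=> w; rewrite /word_inv map_rev revK -map_comp map_id_in // => -[g b] _ /=.
by rewrite negbK.
Qed.

Fact word_mulV w : pol2_equiv (w ++ word_inv w) [::].
Proof.
elim: w => [|[g b] w IHw]; first exact: pol2_refl.
rewrite -cat1s word_inv_cat -catA (catA w).
apply: pol2_trans (pol2_cancel g b).
rewrite -[X in pol2_equiv _ X]/([:: (g, b)] ++ [::] ++ [:: (g, ~~ b)]).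
by apply: pol2_cat; [apply: pol2_refl | apply: pol2_cat => //; apply: pol2_refl].
Qed.

Fact word_mulVl w : pol2_equiv (word_inv w ++ w) [::].
Proof. by have := word_mulV (word_inv w); rewrite word_invK. Qed.

Fact word_inv_equiv u v : pol2_equiv u v -> pol2_equiv (word_inv u) (word_inv v).
Proof.
move=> e; apply: (@pol2_trans _ (word_inv u ++ (v ++ word_inv v))).
  rewrite -[X in pol2_equiv X _]cats0; apply: pol2_cat; first exact: pol2_refl.
  exact/pol2_sym/word_mulV.
rewrite catA -[X in pol2_equiv _ X]cat0s.
apply: pol2_cat; last exact: pol2_refl.
apply: pol2_trans (word_mulVl u).
by apply: pol2_cat; [apply: pol2_refl | apply: pol2_sym].
Qed.

Fact pol2_mulE u v : pol2_mul (pol2_class u) (pol2_class v) = pol2_class (u ++ v).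
Proof. by apply/pol2_classP/pol2_cat; apply: pol2_repr. Qed.

Fact pol2_invE u : pol2_inv (pol2_class u) = pol2_class (word_inv u).
Proof. by apply/pol2_classP/word_inv_equiv/pol2_repr. Qed.

Fact pol2_mulA : associative pol2_mul.
Proof.
move=> a b c; rewrite -[a]pol2_classK -[b]pol2_classK -[c]pol2_classK.
by rewrite !pol2_mulE catA.
Qed.

Fact pol2_mul1l : left_id pol2_one pol2_mul.
Proof. by move=> a; rewrite -[a]pol2_classK pol2_mulE. Qed.

Fact pol2_mul1r : right_id pol2_one pol2_mul.
Proof. by move=> a; rewrite -[a]pol2_classK pol2_mulE cats0. Qed.

Fact pol2_mulVl : left_inverse pol2_one pol2_inv pol2_mul.
Proof.
move=> a; rewrite -[a]pol2_classK pol2_invE pol2_mulE.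
exact/pol2_classP/word_mulVl.
Qed.

Fact pol2_mulVr : right_inverse pol2_one pol2_inv pol2_mul.
Proof.
move=> a; rewrite -[a]pol2_classK pol2_invE pol2_mulE.
exact/pol2_classP/word_mulV.
Qed.

HB.instance Definition _ := isGroup.Build Pol2
  pol2_mulA pol2_mul1l pol2_mul1r pol2_mulVl pol2_mulVr.

Definition pol2_gen (g : G) : Pol2 := pol2_class [:: (g, false)].

Lemma pol2_class_cat u v : pol2_class (u ++ v) = (pol2_class u * pol2_class v)%g.
Proof. by rewrite [RHS]pol2_mulE. Qed.

Lemma pol2_classV g : pol2_class [:: (g, true)] = (pol2_gen g)^-1%g.
Proof. by rewrite [RHS]pol2_invE. Qed.

Lemma pol2_gen_rel g1 g2 g3 : pol2_gen (g1 * g2 * g3)%g =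
  (pol2_gen (g1 * g2) * (pol2_gen g2)^-1 * (pol2_gen g1)^-1 * pol2_gen (g1 * g3)
    * (pol2_gen g3)^-1 * pol2_gen (g2 * g3))%g.
Proof.
rewrite /pol2_gen; move/pol2_classP: (pol2_rel g1 g2 g3) => ->.
by rewrite -!pol2_classV -!pol2_class_cat.
Qed.

Lemma pol2_gen_unital : unital pol2_gen.
Proof.
have := pol2_gen_rel 1%g 1%g 1%g; rewrite !mulg1 mulgV mul1g mulgVK mulVg.
by [].
Qed.

Lemma quadratic_rel (H : groupType) (phi : G -> H) : unital phi ->
  quadratic phi <-> forall g1 g2 g3, phi (g1 * g2 * g3)%g =
    (phi (g1 * g2) * (phi g2)^-1 * (phi g1)^-1 * phi (g1 * g3)
      * (phi g3)^-1 * phi (g2 * g3))%g.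
Proof.
move=> phi1.
have DDE a b g : Delta b (Delta a phi) g =
    (phi (a * b * g) * (phi (b * g))^-1 * phi g * (phi (a * g))^-1)%g.
  by rewrite /Delta invgM invgK !mulgA.
split=> [quad a b c|rel a b c g]; last first.
  have DDc k : Delta b (Delta a phi) k = (phi (a * b) * (phi b)^-1 * (phi a)^-1)%g.
    by rewrite DDE rel mulgK mulgVK mulgK.
  by rewrite {1}/Delta !DDc mulgV.
have /eqP := quad a b c 1%g; rewrite /= {1}/Delta divg_eq1 !DDE !mulg1 phi1 mulg1.
by move=> /eqP <-; rewrite mulgVK mulgK mulgVK.
Qed.

(* pol2_gen is the universal unital quadratic map. *)
Lemma pol2_gen_quadratic : quadratic pol2_gen.
Proof. exact/(quadratic_rel pol2_gen_unital)/pol2_gen_rel. Qed.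

Section Universal.
Variables (H : groupType) (phi : G -> H).
Hypotheses (phi1 : unital phi) (phi_quad : quadratic phi).

Let letter (x : G * bool) : H := if x.2 then (phi x.1)^-1%g else phi x.1.

Fixpoint word_eval (w : word) : H :=
  if w is x :: w' then (letter x * word_eval w')%g else 1%g.

Fact word_eval_cat u v : word_eval (u ++ v) = (word_eval u * word_eval v)%g.
Proof. by elim: u => [|x u /= ->]; rewrite ?mul1g ?mulgA. Qed.

Fact word_eval_equiv u v : pol2_equiv u v -> word_eval u = word_eval v.
Proof.
elim=> {u v} [u|u v _ ->|u v w _ -> _ ->|u u' v v' _ e1 _ e2|g b|g1 g2 g3] //=.
- by rewrite !word_eval_cat e1 e2.
- by rewrite /letter mulg1; case: b; rewrite ?mulVg ?mulgV.
- rewrite /letter /= !mulg1 !mulgA.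
  by have /(quadratic_rel phi1) -> := phi_quad.
Qed.

Lemma pol2_universal : exists! theta : Pol2 -> H,
  {morph theta : a b / (a * b)%g} /\ forall g, theta (pol2_gen g) = phi g.
Proof.
pose theta (a : Pol2) := word_eval (repr a).
have thetaE w : theta (pol2_class w) = word_eval w.
  by apply: word_eval_equiv; apply: pol2_repr.
exists theta; split.
  split=> [a b|g]; last by rewrite thetaE /= mulg1.
  rewrite -[a]pol2_classK -[b]pol2_classK -pol2_class_cat !thetaE.
  exact: word_eval_cat.
move=> theta' [thetaM thetag]; apply/funext => a.
have theta1 : theta' 1%g = 1%g.
  by apply: (mulgI (theta' 1%g)); rewrite -thetaM !mulg1.
rewrite -[a]pol2_classK thetaE; elim: (repr a) => [|[g b] w IHw].
  exact: esym theta1.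
rewrite -cat1s pol2_class_cat thetaM -IHw word_eval_cat /= mulg1; congr (_ * _)%g.
case: b; last exact: esym (thetag g).
apply/(mulgI (phi g)); rewrite /letter /= mulgV.
by rewrite -{1}thetag pol2_classV -thetaM mulgV theta1.
Qed.

End Universal.

End Pol2.

(* Main.v *)
(* For a unital map phi, let A(g, h) = phi(g) phi(h) phi(gh)^-1. The map phi is
   quadratic iff A(a, bc) = A(a, c) A(a, b). The conjugate of A(b, -) by phi(a)
   then reverses products as well, and comparing this with the cocycle identity
   for A shows that all the values of A commute. Hence A(a, -) factors through
   the abelianization, and A extends to an additive map T from the tensor
   product of omega(G) and G^ab to an abelian subgroup, with T(psi(g, h)) =
   A(g, h) and T(k m) = phi(k) T(m) phi(k)^-1. So (m, g) |-> T(m) phi(g) is a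
   homomorphism: the crossed product, with the map g |-> (0, g), has the
   universal property of Pol_2(G). *)
Require Import Defs.
From HB Require Import structures.
From mathcomp Require Import all_boot all_algebra boolp.

Set Implicit Arguments.
Unset Strict Implicit.
Unset Printing Implicit Defensive.

Import GRing.Theory.

Local Open Scope ring_scope.

(** * Commutation and the center of a centralizer *)

Lemma commuteJ (H : groupType) (z x y : H) :
  commute x y -> commute (x ^ z)%g (y ^ z)%g.
Proof. by rewrite /commute -!conjMg => ->. Qed.

Lemma commute_conjg (H : groupType) (x y z : H) :
  commute x y -> commute x z -> commute x (y ^ z)%g.
Proof.
move=> xy xz; rewrite conjgE; apply: commuteM; first exact: commuteV.
exact: commuteM.
Qed.

Section CenterOfCentralizer.
Variables (H : groupType) (S : H -> Prop).
Implicit Types x y z : H.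

Definition in_centralizer x := forall s, S s -> commute x s.

Definition center_centralizer_pred : {pred H} := [pred x |
  `[< in_centralizer x /\ forall y, in_centralizer y -> commute x y >]].

(* Abelian whatever S is, and containing S as soon as the elements of S commute
   with each other. *)
Record center_centralizer := CenterCentralizer {
  center_val :> H;
  center_valP : center_val \in center_centralizer_pred
}.

HB.instance Definition _ := [isSub for center_val].
HB.instance Definition _ := [Choice of center_centralizer by <:].

Implicit Types u v : center_centralizer.

Lemma center_centralizerP x : reflect
  (in_centralizer x /\ forall y, in_centralizer y -> commute x y)
  (x \in center_centralizer_pred).
Proof. exact: asboolP. Qed.

Fact center_one_proof : (1%g : H) \in center_centralizer_pred.
Proof.
by apply/center_centralizerP; split=> y _; apply/commute_sym/commute1.
Qed.

Fact center_mul_proof u v :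
  (center_val u * center_val v)%g \in center_centralizer_pred.
Proof.
have [uS uC] := center_centralizerP _ (center_valP u).
have [vS vC] := center_centralizerP _ (center_valP v).
apply/center_centralizerP; split=> y yS; apply/commute_sym/commuteM/commute_sym.
- exact/commute_sym/uS.
- exact: vS.
- exact/commute_sym/uC.
- exact: vC.
Qed.

Fact center_inv_proof u : (center_val u)^-1%g \in center_centralizer_pred.
Proof.
have [uS uC] := center_centralizerP _ (center_valP u).
apply/center_centralizerP; split=> y yS; apply/commute_sym/commuteV/commute_sym.
  exact: uS.
exact: uC.
Qed.

Definition center_zero := CenterCentralizer center_one_proof.
Definition center_add u v := CenterCentralizer (center_mul_proof u v).
Definition center_opp u := CenterCentralizer (center_inv_proof u).

Fact center_addA : associative center_add.
Proof. by move=> u v w; apply/val_inj/mulgA. Qed.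

Fact center_addC : commutative center_add.
Proof.
move=> u v; apply: val_inj => /=.
have [_ uC] := center_centralizerP _ (center_valP u).
have [vS _] := center_centralizerP _ (center_valP v).
exact: uC.
Qed.

Fact center_add0 : left_id center_zero center_add.
Proof. by move=> u; apply/val_inj/mul1g. Qed.

Fact center_addN : left_inverse center_zero center_opp center_add.
Proof. by move=> u; apply/val_inj/mulVg. Qed.

HB.instance Definition _ := GRing.isZmodule.Build center_centralizer
  center_addA center_addC center_add0 center_addN.

Lemma center_valD u v : center_val (u + v) = (center_val u * center_val v)%g.
Proof. by []. Qed.

Lemma center_valB u v : center_val (u - v) = (center_val u / center_val v)%g.
Proof. by []. Qed.

Hypothesis S_comm : forall x y, S x -> S y -> commute x y.

Lemma mem_center_centralizer x : S x -> x \in center_centralizer_pred.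
Proof.
move=> Sx; apply/center_centralizerP; split=> y Sy; first exact: S_comm.
exact/commute_sym/Sy.
Qed.

End CenterOfCentralizer.

(** * Generators of the augmentation ideal and of the tensor product *)

Lemma tensBl (A B : zmodType) (a a' : A) (b : B) :
  tens (a - a') b = tens a b - tens a' b.
Proof. by apply/eqP; rewrite eq_sym subr_eq -tensDl subrK. Qed.

Lemma tens0l (A B : zmodType) (b : B) : tens (0 : A) b = 0.
Proof. by rewrite -(subrr 0) tensBl subrr. Qed.

Section Generation.
Variable G : groupType.
Implicit Types x y : group_ring G.

Fact reduced_proof x :
  (x - (augmentation x)%:~R : (group_ring G)^o) \in @augmentation_ideal G.
Proof. by rewrite inE raddfB /= rmorph_int intz subrr. Qed.

(** The map [x |-> x - augmentation x] is additive, is the identity on the ideal and sends [gr g] to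
    [taut_cocycle g], so induction over [group_ring G] applies. *)
Lemma omega_ind (P : omega G -> Prop) :
  P 0 -> (forall u v, P u -> P v -> P (u - v)) ->
  (forall g, P (taut_cocycle g)) -> forall u, P u.
Proof.
move=> P0 PB Pc u.
suff Pred x : P (Omega (reduced_proof x)).
  have -> : u = Omega (reduced_proof (omega_val u)); last exact: Pred.
  apply: val_inj => /=; have /eqP -> := omega_valP u.
  by rewrite subr0.
elim/gr_ind: x => [|x y IHx IHy|g].
- rewrite (_ : Omega _ = 0) //; apply: val_inj => /=.
  by rewrite raddf0 subrr.
- rewrite (_ : Omega _ = Omega (reduced_proof x) - Omega (reduced_proof y)).
    exact: PB.
  by apply: val_inj => /=; rewrite raddfB /= rmorphB /= opprD addrACA -opprD.
- rewrite (_ : Omega _ = taut_cocycle g) //; apply: val_inj => /=.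
  by rewrite augmentation_gr.
Qed.

Lemma tensor_omega_ab_ind
    (P : tensor (omega G) (abelianization G) -> Prop) :
  P 0 -> (forall t u, P t -> P u -> P (t - u)) ->
  (forall g h, P (psi_fun g h)) -> forall t, P t.
Proof.
move=> P0 PB Pc; elim/tensor_ind => [|t u Pt Pu|x b] //; first exact: PB.
have [h ->] := ab_surj b.
elim/omega_ind: x => [|x y Px Py|g]; last exact: Pc.
  by rewrite tens0l.
by rewrite tensBl; apply: PB.
Qed.

End Generation.

(* Locked because unification would otherwise expand it to match products. *)
HB.lock Definition defect (G H : groupType) (phi : G -> H) (g h : G) : H :=
  (phi g * phi h * (phi (g * h))^-1)%g.

(** * The defect of a quadratic map *)

Section QuadraticDefect.
Variables (G H : groupType) (phi : G -> H).
Hypotheses (phi1 : unital phi) (phi_quad : quadratic phi).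
Local Notation defect := (defect phi).

Lemma defectE g h : (defect g h * phi (g * h) = phi g * phi h)%g.
Proof. by rewrite defect.unlock mulgVK. Qed.

Lemma defect1l h : defect 1%g h = 1%g.
Proof. by rewrite defect.unlock phi1 !mul1g mulgV. Qed.

(** With A the defect, the quadratic relation reads phi(abc) = A(a,b)^-1 A(a,c)^-1 phi(a)
    phi(bc). *)
Lemma defect_antiM a b c : defect a (b * c)%g = (defect a c * defect a b)%g.
Proof.
have /(quadratic_rel phi1)/(_ a b c) := phi_quad.
rewrite -mulgA defect.unlock => ->.
by rewrite !invgM !invgK !mulgA mulgK.
Qed.

(** Associativity: the two bracketings of [phi a * phi b * phi c]. *)
Lemma defect_conj_cocycle a b c : (defect b c ^ (phi a)^-1 =
  defect a b * defect (a * b) c * (defect a (b * c))^-1)%g.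
Proof. by rewrite conjgE defect.unlock !invgM !invgK !mulgA !mulgVK. Qed.

(* Both [defect a] and [c |-> defect b c ^ (phi a)^-1] reverse products;
   comparing the two expansions of the latter at [c * d] gives this. *)
Lemma defect_commute_conj a b c d :
  commute (defect a d) (defect b c ^ (phi a)^-1)%g.
Proof.
(* A conjugate of [defect (a * b) e], so this product reverses products in [e] as well. *)
have zE e : (defect b e ^ (phi a)^-1 * defect a e =
    defect (a * b) e ^ (defect a b)^-1)%g.
  rewrite defect_conj_cocycle defect_antiM conjgE invgK invgM.
  by rewrite !mulgA mulgVK.
have := zE (c * d)%g; rewrite !defect_antiM !conjMg -!zE.
move: (defect b c ^ _)%g (defect b d ^ _)%g => zc zd.
rewrite -!mulgA => /mulgI; rewrite !mulgA => /mulIg.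
exact: esym.
Qed.

(** By [commJ], [defect c d] commutes with conjugates by [phi a^-1], while [defect a b] is the
    inverse of the conjugate of [defect a^-1 b] by [(phi a)^-1]. The two conjugators differ by
    [(defect a^-1 a)^-1], whose conjugate by [phi a^-1] is again covered by [commJ]. *)
Lemma defect_commute a b c d : commute (defect a b) (defect c d).
Proof.
have commJ e : commute (defect c d) (defect a^-1 e ^ phi a^-1)%g.
  have /(commuteJ (phi a^-1)%g) := defect_commute_conj a^-1 c d e.
  by rewrite conjgKV; apply: commute_sym.
have phiV : ((phi a)^-1 = (defect a^-1 a)^-1 * phi a^-1)%g.
  by rewrite defect.unlock mulVg phi1 invg1 mulg1 invgM mulgVK.
have : (defect a b = (defect a^-1 b ^ (phi a)^-1)^-1)%g.
  rewrite defect_conj_cocycle mulgV defect1l mulg1 defect_antiM.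
  by rewrite invgM invgK mulgK.
rewrite phiV conjgM conjJg conjVg => ->.
by apply/commute_sym/commuteV/commute_conjg => //; apply: commuteV.
Qed.

Lemma defectMr a b c : defect a (b * c)%g = (defect a b * defect a c)%g.
Proof. by rewrite defect_antiM; apply: defect_commute. Qed.

(** The counterpart of [psi_scale]: it makes conjugation by [phi a] correspond to the action of
    [gr a]. *)
Lemma defect_conj a b c :
  (defect b c ^ (phi a)^-1 = defect (a * b) c * (defect a c)^-1)%g.
Proof.
rewrite defect_conj_cocycle defect_antiM invgM.
by rewrite (defect_commute a b (a * b)%g c) -mulgA mulVKg.
Qed.

End QuadraticDefect.

(** * Generators of the crossed product *)

Section CrossedGenerators.
Variable G : groupType.
Local Notation M := (tensor (omega G) (abelianization G)).
Local Notation C := (crossed_product (psi G)).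

Definition crossed_gen (g : G) : C := (0, g).

Definition crossed_inl (m : M) : C := (m, 1%g).

Lemma taut_cocycle1 : taut_cocycle (1%g : G) = 0.
Proof. by apply: val_inj; rewrite /= gr1 subrr. Qed.

Lemma psi1l (h : G) : psi_fun 1%g h = 0.
Proof. by rewrite /psi_fun taut_cocycle1 tens0l. Qed.

Lemma psiDr (g h k : G) : psi_fun g (h * k)%g = psi_fun g h + psi_fun g k.
Proof. by rewrite /psi_fun abM tensDr. Qed.

Lemma psi_scale (k g h : G) :
  gr k *: psi_fun g h = psi_fun (k * g)%g h - psi_fun k h :> M.
Proof.
rewrite /psi_fun gr_scale_tens gr_scale_ab taut_cocycleM tensDl addrC.
exact/esym/addKr.
Qed.

Lemma crossed_oneE : 1%g = (0, 1%g) :> C.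
Proof. by rewrite -[LHS]/(- psi_fun 1%g 1%g, 1%g) psi1l oppr0. Qed.

Lemma crossed_mulE (m n : M) (g h : G) : (((m, g) : C) * ((n, h) : C) =
  ((m + gr g *: n + psi_fun g h)%R, g * h) :> C)%g.
Proof. by []. Qed.

Lemma crossed_gen_unital : unital crossed_gen.
Proof. exact/esym/crossed_oneE. Qed.

Lemma crossed_inlD (m n : M) :
  crossed_inl (m + n) = (crossed_inl m * crossed_inl n)%g.
Proof.
by rewrite crossed_mulE psi1l gr1 scale1r addr0 mulg1.
Qed.

Lemma crossed_inlN (m : M) : crossed_inl (- m) = (crossed_inl m)^-1%g.
Proof.
apply: (mulgI (crossed_inl m)).
by rewrite -crossed_inlD subrr mulgV crossed_oneE.
Qed.

Lemma crossed_inl_gen (m : M) (g : G) :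
  (m, g) = (crossed_inl m * crossed_gen g)%g :> C.
Proof.
by rewrite crossed_mulE psi1l scaler0 !addr0 mul1g.
Qed.

Lemma crossed_genM (g h : G) : (crossed_gen g * crossed_gen h)%g =
  (crossed_inl (psi_fun g h) * crossed_gen (g * h))%g.
Proof. by rewrite -crossed_inl_gen crossed_mulE scaler0 !add0r. Qed.

Lemma crossed_gen_quadratic : quadratic crossed_gen.
Proof.
apply/(quadratic_rel crossed_gen_unital) => a b c.
have genE g h : crossed_gen (g * h)%g =
    ((crossed_inl (psi_fun g h))^-1 *
     (crossed_gen g * crossed_gen h))%g.
  by rewrite crossed_genM mulKg.
(* Applied with [u], [v] the inverses of the cocycle terms of [(a, b)], [(a, c)], and [x], [y], [z],
   [t] the generators at [a], [b], [c], [b * c]. By [psiDr], [u * v] inverts the cocycle term of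
   [(a, b * c)]. *)
have collect (K : groupType) (u v x y z t : K) : (u * v * (x * t) =
    u * (x * y) * y^-1 * x^-1 * (v * (x * z)) * z^-1 * t)%g.
  by rewrite !mulgA !mulgK.
rewrite -(mulgA a b c) (genE a (b * c)%g) (genE a b) (genE a c).
rewrite psiDr (addrC (psi_fun a b)) crossed_inlD invgM.
exact: collect.
Qed.

End CrossedGenerators.

(** * Universal property of the crossed product *)

Section CrossedUniversal.
Variables (G H : groupType).
Local Notation M := (tensor (omega G) (abelianization G)).
Local Notation C := (crossed_product (psi G)).

(** By [crossed_genM], each [crossed_inl (psi_fun g h)] is a word in the generators, and the values
    of [psi_fun] generate [M]. *)
Lemma crossed_hom_eq (s s' : C -> H) :
  {morph s : u v / (u * v)%g} -> {morph s' : u v / (u * v)%g} ->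
  (forall g, s (crossed_gen g) = s' (crossed_gen g)) -> s =1 s'.
Proof.
move=> sM s'M ss'.
have hom1 (r : C -> H) : {morph r : u v / (u * v)%g} -> r 1%g = 1%g.
  by move=> rM; apply: (mulgI (r 1%g)); rewrite -rM !mulg1.
have homV (r : C -> H) u : {morph r : u v / (u * v)%g} -> r u^-1%g = (r u)^-1%g.
  by move=> rM; apply: (mulgI (r u)); rewrite -rM !mulgV hom1.
suff eqM m : s (crossed_inl m) = s' (crossed_inl m).
  by move=> [m g]; rewrite crossed_inl_gen sM s'M eqM ss'.
elim/tensor_omega_ab_ind: m => [|t u Et Eu|g h].
- by rewrite -[crossed_inl 0]crossed_oneE !hom1.
- by rewrite crossed_inlD crossed_inlN sM s'M !homV // Et Eu.
- apply: (mulIg (s (crossed_gen (g * h)))).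
  by rewrite -sM ss' -s'M -crossed_genM sM s'M !ss'.
Qed.

Variable phi : G -> H.
Hypotheses (phi1 : unital phi) (phi_quad : quadratic phi).

Let is_defect (x : H) := exists g h, x = defect phi g h.
Local Notation V := (center_centralizer is_defect).

Fact is_defect_comm x y : is_defect x -> is_defect y -> commute x y.
Proof. by move=> [a [b ->]] [c [d ->]]; apply: defect_commute. Qed.

Fact defectP g h : is_defect (defect phi g h).
Proof. by exists g, h. Qed.

Definition central_defect (g h : G) : V :=
  CenterCentralizer (mem_center_centralizer is_defect_comm (defectP g h)).

Lemma central_defectM g : {morph central_defect g : h k / (h * k)%g >-> h + k}.
Proof. by move=> h k; apply/val_inj/defectMr. Qed.

(** A map turning products into sums vanishes on [derived], hence descends along [ab]. *)
Lemma central_defect_ab g h :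
  central_defect g (repr (ab h)) = central_defect g h.
Proof.
have D1 : central_defect g 1%g = 0.
  by apply: (addrI (central_defect g 1%g));
    rewrite -central_defectM mulg1 addr0.
have DV k : central_defect g k^-1%g = - central_defect g k.
  by apply: (addrI (central_defect g k));
    rewrite -central_defectM mulgV D1 subrr.
suff D0 k : derived k -> central_defect g k = 0.
  by apply/eqP; rewrite -subr_eq0 -DV -central_defectM (D0 _ (ab_repr h)).
elim=> [x y||x y _ Dx _ Dy|x _ Dx] //.
- rewrite commgEl conjgE !central_defectM !DV.
  by rewrite addrCA addKr addNr.
- by rewrite central_defectM Dx Dy addr0.
- by rewrite DV Dx oppr0.
Qed.

Lemma omega_tensor_defect : exists2 T : M -> V, zmod_morphism T &
  forall g h, T (psi_fun g h) = central_defect g h.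
Proof.
(* Extended linearly from the group elements to Z[G], then restricted to the ideal: at g - 1 the
   term coming from 1 vanishes by [defect1l]. *)
pose f (x : omega G) (b : abelianization G) : V :=
  malg_lift (fun g => central_defect g (repr b)) (omega_val x).
have fDl x y b : f (x + y) b = f x b + f y b by rewrite /f raddfD.
have fDr x b b' : f x (b + b') = f x b + f x b'.
  rewrite /f malg_lift.unlock -big_split; apply: eq_bigr => g _.
  have [h ->] := ab_surj b; have [h' ->] := ab_surj b'.
  by rewrite -abM !central_defect_ab central_defectM mulrzDl.
exists (tensor_lift f); first exact: tensor_lift_is_zmod_morphism.
move=> g h; rewrite tensor_lift_tens // /f /=.
rewrite malg_lift_is_zmod_morphism !malg_liftU !mulr1z.
rewrite !central_defect_ab (_ : central_defect 1%g h = 0) ?subr0 //.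
by apply/val_inj/defect1l.
Qed.

Lemma crossed_lift : exists2 s : C -> H, {morph s : u v / (u * v)%g} &
  forall g, s (crossed_gen g) = phi g.
Proof.
have [T TB Tgen] := omega_tensor_defect.
have T0 : T 0 = 0 by rewrite -(subrr 0) TB subrr.
have TD t u : T (t + u) = T t + T u.
  by rewrite -{1}[u]opprK TB -(sub0r u) TB T0 sub0r opprK.
have TgenE g h : defect phi g h = center_val (T (psi_fun g h)) by rewrite Tgen.
have Tconj k m : center_val (T (gr k *: m)) = (center_val (T m) ^ (phi k)^-1)%g.
  elim/tensor_omega_ab_ind: m => [|t u Et Eu|g h].
  - by rewrite scaler0 T0 conj1g.
  - by rewrite scalerBr !TB !center_valB Et Eu conjMg conjVg.
  - rewrite psi_scale TB center_valB.
    have := defect_conj phi1 phi_quad k g h.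
    by rewrite !TgenE => ->.
exists (fun u : C => center_val (T u.1) * phi u.2)%g => [[m g] [n h]|g].
  (* [defectE] turns the cocycle term times [phi (g * h)] into [phi g * phi h], and this [phi g]
     cancels against the conjugation from [Tconj]. *)
  rewrite crossed_mulE /= !TD !center_valD Tconj Tgen /=.
  by rewrite -(mulgA _ (defect phi g h)) defectE conjgE invgK !mulgA mulgVK.
by rewrite /= T0 mul1g.
Qed.

End CrossedUniversal.

Theorem theorem1p3 (G : groupType) :
  exists f : {multiplicative Pol2 G -> crossed_product (psi G)}, bijective f.
Proof.
have [f [[fM fgen] _]] :=
  pol2_universal (@crossed_gen_unital G) (@crossed_gen_quadratic G).
have [s sM sgen] := crossed_lift (pol2_gen_unital G) (@pol2_gen_quadratic G).
pose fmor := isMultiplicative.Build _ _ f fM.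
exists (HB.pack_for {multiplicative Pol2 G -> crossed_product (psi G)} f fmor).
(* Both composites fix the generators, so each is the identity by the uniqueness of homomorphisms on
   its side. *)
exists s => /= [a|u].
  have [r [_ runiq]] :=
    pol2_universal (pol2_gen_unital G) (@pol2_gen_quadratic G).
  have rE : r = s \o f.
    by apply: runiq; split=> [x y|g] /=; rewrite ?fM ?sM ?fgen ?sgen.
  by rewrite -[LHS]/((s \o f) a) -rE (runiq id).
apply: (@crossed_hom_eq G _ (f \o s) id) => [v w|//|g] /=.
  by rewrite sM fM.
by rewrite sgen fgen.
Qed.
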